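(* Suppose that $n\ge 1$, $\delta\in(0,n]$ and $f\in \mathrm{N}L^1(\mathbb{R}^n,\tilde{\mathcal H}^\delta_\infty)$. (1) If $\delta=n$ and $f$ is Lebesgue measurable, then $f$ is an $\mathrm{N}L^1$-limit of continuous functions. (2) If $f$ is an $\mathrm{N}L^1$-limit of continuous functions, then $f$ is Lebesgue measurable.
   Context: Dyadic cubes: for $k\in\mathbb{Z}$ let $\mathcal Q_k$ be the collection of half-open cubes $Q$ with vertices in the lattice $(2^k\mathbb{Z})^n$, each a translate of $[0,2^k)^n$; its side length is $\ell(Q)=2^k$. Dyadic cubes are the elements of $\bigcup_{k\in\mathbb{Z}}\mathcal Q_k$. Dyadic Hausdorff content: for $\delta\in(0,n]$ and any $E\subset\mathbb{R}^n$, $\tilde{\mathcal H}^\delta_\infty(E):=\inf\{\sum_{i}\ell(Q_i)^\delta : E\subset \operatorname{int}(\bigcup_{i}Q_i)\}$, the infimum being over all countable (or finite) collections of dyadic cubes $Q_i$. Choquet integral: for any set $\Omega\subset\mathbb{R}^n$ and any function $f:\Omega\to[0,\infty]$ (no measurability required), $\int_\Omega f\,d\tilde{\mathcal H}^\delta_\infty:=\int_0^\infty\tilde{\mathcal H}^\delta_\infty(\{x\in\Omega: f(x)>t\})\,dt$. $\mathrm{N}L^1(\Omega,\tilde{\mathcal H}^\delta_\infty)$ is the set of all (possibly non-measurable) functions $f:\Omega\to[-\infty,\infty]$ with $\int_\Omega|f|\,d\tilde{\mathcal H}^\delta_\infty<\infty$, functions coinciding outside a set of zero $\tilde{\mathcal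 H}^\delta_\infty$-content being identified. A function $f\in\mathrm{N}L^1(\mathbb{R}^n,\tilde{\mathcal H}^\delta_\infty)$ is an $\mathrm{N}L^1$-limit of continuous functions if there is a sequence of continuous functions $\phi_i:\mathbb{R}^n\to\mathbb{R}$ such that $\int_{\mathbb{R}^n}|f-\phi_i|\,d\tilde{\mathcal H}^\delta_\infty\to 0$ as $i\to\infty$. *)

(* Defs.v *)
From HB Require Import structures.
From mathcomp Require Import all_boot all_order all_algebra.
From mathcomp Require Import all_classical all_reals all_analysis.
From mathcomp Require Import measurable_realfun.

Set Implicit Arguments.
Unset Strict Implicit.
Unset Printing Implicit Defensive.
Import Order.TTheory GRing.Theory Num.Theory.
Import numFieldNormedType.Exports.

Local Open Scope classical_set_scope.
Local Open Scope ring_scope.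

(* The pair (k, m) encodes the dyadic cube 2^k m + [0, 2^k)^n.  For n >= 1 the
   encoding is injective. *)
Definition dyadic (n : nat) : Type := (int * 'rV[int]_n)%type.

Section dyadic_content.
Context {R : realType} {n : nat}.
Implicit Types (delta : R) (E Omega : set 'rV[R]_n) (f : 'rV[R]_n -> \bar R).

Definition side (q : dyadic n) : R := 2 ^ q.1.

Definition cube (q : dyadic n) : set 'rV[R]_n :=
  [set x | forall i : 'I_n,
    (q.2 ord0 i)%:~R * side q <= x ord0 i < (q.2 ord0 i + 1)%:~R * side q].

(* A collection is a set D of cubes; it is automatically at most countable
   since there are countably many dyadic cubes. *)
Definition hcontent delta E : \bar R :=
  ereal_inf [set (\esum_(q in D) (side q `^ delta)%:E)%E
            | D in [set D : set (dyadic n) |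
                      E `<=` (\bigcup_(q in D) cube q)° ]].

(* The integrand is nonincreasing in t, hence Borel measurable, so the Lebesgue
   integral is the intended one even if f is not measurable. *)
Definition choquet delta Omega f : \bar R :=
  (\int[lebesgue_measure]_(t in `[0%R, +oo[)
     hcontent delta [set x | Omega x /\ t%:E < f x])%E.

(* Membership in NL^1(Omega), for a representative f. *)
Definition NL1 delta Omega f : Prop :=
  (choquet delta Omega (fun x => `|f x|) < +oo)%E.

Definition NL1_limit_of_continuous delta f : Prop :=
  exists phi : nat -> 'rV[R]_n -> R,
    (forall i, continuous (phi i)) /\
    choquet delta setT (fun x => `|f x - (phi i x)%:E|%E) @[i --> \oo] --> 0%E.

End dyadic_content.

Section lebesgue.
Context {R : realType} {n : nat}.
(* The dimension is n.+1: in dimension 0 the only box is nonempty, and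
   lebesgue_outer set0 would be 1. *)
Implicit Types (b : 'rV[R]_n.+1 * 'rV[R]_n.+1) (A : set 'rV[R]_n.+1).

Definition box b : set 'rV[R]_n.+1 :=
  [set x | forall i, b.1 ord0 i <= x ord0 i < b.2 ord0 i].

Definition box_volume b : R :=
  \prod_i Num.max 0 (b.2 ord0 i - b.1 ord0 i).

Definition lebesgue_outer A : \bar R :=
  ereal_inf [set (\sum_(k <oo) (box_volume (B k))%:E)%E
            | B in [set B : nat -> 'rV[R]_n.+1 * 'rV[R]_n.+1 |
                      A `<=` \bigcup_k box (B k)]].

Lemma box_volume_ge0 b : 0 <= box_volume b.
Proof. by apply: prodr_ge0 => i _; rewrite le_max lexx. Qed.

Lemma lebesgue_outer_ge0 A : (0 <= lebesgue_outer A)%E.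
Proof.
apply: le_ereal_inf_tmp => x [B AB <-{x}].
by apply: nneseries_ge0 => k _ _; rewrite lee_fin box_volume_ge0.
Qed.

Lemma le_lebesgue_outer : {homo lebesgue_outer : A B / A `<=` B >-> (A <= B)%E}.
Proof.
move=> A B AB; apply/ereal_inf_le_tmp => x [C BC <-{x}].
by exists C => //; apply: subset_trans AB BC.
Qed.

Lemma lebesgue_outer0 : lebesgue_outer set0 = 0%E.
Proof.
apply/eqP; rewrite eq_le lebesgue_outer_ge0 andbT.
apply: ereal_inf_lbound; exists (fun=> (0, 0)) => //.
apply: eseries0 => k _ _; congr (_%:E).
by rewrite /box_volume big_ord_recl subrr maxxx mul0r.
Qed.

Lemma lebesgue_outer_sigma_subadditive : sigma_subadditive lebesgue_outer.
Proof.
move=> A; have [[i ioo]|] := pselect (exists i, lebesgue_outer (A i) = +oo%E).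
  rewrite (eseries_pinfty _ _ ioo) ?leey// => k _.
  by rewrite -ltNye (lt_le_trans _ (lebesgue_outer_ge0 _)).
rewrite -forallNE => Aoo.
suff add2e (e : {posnum R}) : (lebesgue_outer (\bigcup_n A n)
    <= \sum_(i <oo) lebesgue_outer (A i) + e%:num%:E)%E.
  by apply/lee_addgt0Pr => _/posnumP[].
rewrite (le_trans _ (epsilon_trick _ _ _))//; last first.
  by move=> k; exact: lebesgue_outer_ge0.
pose P k (B : nat -> 'rV[R]_n.+1 * 'rV[R]_n.+1) :=
  A k `<=` \bigcup_j box (B j) /\ (\sum_(j <oo) (box_volume (B j))%:E
    <= lebesgue_outer (A k) + (e%:num / (2 ^ k.+1)%:R)%:E)%E.
have [G PG] : {G & forall k, P k (G k)}.
  apply: (@choice _ _ P) => k; rewrite /P.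
  have en1 : (0 < e%:num / (2 ^ k.+1)%:R)%R by [].
  have fA : lebesgue_outer (A k) \is a fin_num.
    by rewrite ge0_fin_numE ?lebesgue_outer_ge0// ltey; apply/eqP; exact: Aoo.
  have [x [B AB <-] /ltW lB] := lb_ereal_inf_adherent en1 fA.
  by exists B.
pose v (p : nat * nat) := (box_volume (G p.1 p.2))%:E.
have v0 p : (0 <= v p)%E by rewrite lee_fin box_volume_ge0.
apply: (@le_trans _ _ (\esum_(i in setT) v i)%E).
  apply: ereal_inf_lbound => /=.
  have /card_esym/ppcard_eqP[f] := card_nat2.
  exists (fun k => G (f k).1 (f k).2).
    move=> t [i _ /(PG i).1 [j _ Gt]].
    by exists (f^-1%FUN (i, j)) => //=; rewrite invK ?inE.
  by rewrite -(esum_pred_image v f xpredT) ?[fun=> _]set_true// image_eq.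
have -> : (\esum_(i in setT) v i
          = \sum_(i <oo) \sum_(j <oo) (box_volume (G i j))%:E)%E.
  pose J : nat -> set (nat * nat) := fun i => [set (i, j) | j in setT].
  rewrite (_ : setT = \bigcup_k J k); last first.
    by rewrite predeqE => -[a b]; split => // _; exists a => //; exists b.
  rewrite esum_bigcupT//=; last first.
    apply/trivIsetP => i j _ _ ij.
    rewrite predeqE => -[k m] /=; split => //= -[] [_] _ [<-{k} _].
    by move=> [m' _] [] /esym/eqP; rewrite (negbTE ij).
  rewrite -(image_id [set: nat]) -fun_true esum_pred_image//; last first.
    by move=> k _; exact: esum_ge0.
  apply: eq_eseriesr => /= j _.
  rewrite -(esum_pred_image v (pair j) predT)//=; last first.
    by move=> ? ? _ _; exact: (@can_inj _ _ _ snd).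
  by congr esum; rewrite predeqE => -[a b]; split; move=> [i _ <-]; exists i.
apply: lee_nneseries => k *; last exact: (PG k).2.
by apply: nneseries_ge0 => j _ _; exact: (v0 (k, j)).
Qed.

HB.instance Definition _ := isOuterMeasure.Build R 'rV[R]_n.+1 lebesgue_outer
  lebesgue_outer0 lebesgue_outer_ge0 le_lebesgue_outer
  lebesgue_outer_sigma_subadditive.

(* Measurability from the Lebesgue sigma-algebra of R^(n+1) to the Borel
   sigma-algebra of the extended reals. *)
Definition lebesgue_measurable (f : 'rV[R]_n.+1 -> \bar R) : Prop :=
  measurable_fun setT (f : caratheodory_type lebesgue_outer -> \bar R).

End lebesgue.

(* Main.v *)
Require Import Defs.
From mathcomp Require Import all_boot all_order all_algebra.
From mathcomp Require Import all_classical all_reals all_analysis.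
From mathcomp Require Import measurable_realfun.
From mathcomp Require Import lra zify.
Import Order.TTheory GRing.Theory Num.Theory.
Import numFieldNormedType.Exports.
Local Open Scope classical_set_scope.
Local Open Scope ring_scope.

(* For delta = n the dyadic content is the Lebesgue outer measure, and for
   delta <= n it dominates the outer measure on sets of content less than 1, since
   then only cubes of side at most 1 matter.

   (2) By Chebyshev's inequality and Borel-Cantelli, a fast subsequence of the
   continuous functions converges to f off a Lebesgue null set.

   (1) Take phi = e * sum_(j <= N) (psi_j - chi_j), with psi_j and chi_j Urysohn
   functions equal to the indicators of {f >= j e} and {f <= - j e} off a small
   set E (regularity of Lebesgue measure).  The measure of {|f - phi| > t} is then
   at most h (theta t), plus the measure of E for t <= 2 N e, where
   h s = |{|f| > s}|, theta t >= t/2, and theta t >= N e as soon as t >= e.  Since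
   t |-> h (t/2) is integrable, dominated convergence concludes when e -> 0 and
   N e -> oo. *)

(** * Sums over countable index sets *)

Section esum_facts.
Set Implicit Arguments.
Unset Strict Implicit.
Context {R : realType}.

Lemma outer_measure_bigcup_esum (T : Type) (I : countType)
    (mu : {outer_measure set T -> \bar R}) (D : set I) (F : I -> set T) :
  (mu (\bigcup_(i in D) F i) <= \esum_(i in D) mu (F i))%E.
Proof.
(* The family is transported to [nat] along [pickle]; codes of no index in [D] receive the empty
   set, which adds nothing. *)
pose G k := if pickle_inv k is Some i then if i \in D then F i else set0
            else set0.
have mu0 k : (0 <= mu (G k))%E by exact: outer_measure_ge0.
have DG : \bigcup_(i in D) F i `<=` \bigcup_k G k.
  move=> x [i Di Fix]; exists (pickle i) => //.
  by rewrite /G pickleK_inv mem_set.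
apply: (le_trans (le_outer_measure mu _ _ DG)).
apply: (le_trans (outer_measure_sigma_subadditive mu G)).
rewrite nneseries_esumT//.
have -> : (\esum_(i in D) mu (F i) = \esum_(i in pickle @` D) mu (G i))%E.
  rewrite esum_image; last by move=> i j _ _; exact: (pcan_inj pickleK).
  by apply: eq_esum => i Di; rewrite /G pickleK_inv mem_set.
rewrite [leRHS]esum_mkcond; apply: le_esum => k _.
case: ifPn => // kD; rewrite /G.
have := @pickle_invK I k; case: (pickle_inv k) => [i|] /= ik; last first.
  by rewrite outer_measure0.
case: ifPn => [Di|_]; last by rewrite outer_measure0.
by case/negP: kD; apply/mem_set; exists i => //; exact: set_mem.
Qed.

Lemma le_esum_set (I : choiceType) (A B : set I) (a : I -> \bar R) :
  (forall i, 0 <= a i)%E -> A `<=` B ->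
  (\esum_(i in A) a i <= \esum_(i in B) a i)%E.
Proof.
move=> a0 AB; rewrite esum_mkcond [leRHS]esum_mkcond; apply: le_esum => i _.
case: ifPn => [|_]; last by case: ifPn.
by rewrite inE => /AB Bi; rewrite mem_set.
Qed.

(** Making the [J k] disjoint with [seqDU] turns the left side into an iterated sum; putting the
    removed overlaps back only increases it. *)
Lemma le_esum_bigcup (I : choiceType) (J : nat -> set I) (a : I -> \bar R) :
  (forall i, 0 <= a i)%E ->
  (\esum_(i in \bigcup_k J k) a i <= \sum_(k <oo) \esum_(i in J k) a i)%E.
Proof.
move=> a0; rewrite seqDU_bigcup_eq esum_bigcupT//.
rewrite -nneseries_esumT; last by move=> k; exact: esum_ge0.
apply: lee_nneseries => [k _ _|k _]; first exact: esum_ge0.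
by apply: le_esum_set => //; exact: subset_seqDU.
Qed.

Lemma esum_fin_image (J : finType) (I : choiceType) (P : pred J)
    (e : J -> I) (a : I -> \bar R) :
  (forall i, 0 <= a i)%E -> injective e ->
  (\esum_(i in [set e j | j in [set j | P j]]) a i = \sum_(j | P j) a (e j))%E.
Proof.
move=> a0 ei; rewrite esum_image; last by move=> ? ? _ _; exact: ei.
rewrite esum_fset//; last exact: finite_finset.
symmetry; apply: bigfs; first exact: index_enum_uniq.
by move=> j _; rewrite mem_index_enum.
Qed.
End esum_facts.

(** * Dyadic content against Lebesgue outer measure *)

Section boxes.
Set Implicit Arguments.
Unset Strict Implicit.
Context {R : realType} {n : nat}.
Implicit Types (b : 'rV[R]_n.+1 * 'rV[R]_n.+1) (A E : set 'rV[R]_n.+1).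

Lemma lebesgue_outer_box b : (lebesgue_outer (box b) <= (box_volume b)%:E)%E.
Proof.
apply: ereal_inf_lbound; exists (fun k => if k == 0%N then b else (0, 0)).
  by move=> x bx; exists 0%N.
rewrite nneseries_recl//; last by move=> *; rewrite lee_fin box_volume_ge0.
rewrite eseries_cond/= eseries0 ?adde0// => -[|k]// _ _.
by rewrite /box_volume big_ord_recl subrr maxxx mul0r.
Qed.

Lemma side_gt0 (q : dyadic n.+1) : 0 < side q :> R.
Proof. exact: exprz_gt0. Qed.

Lemma lebesgue_outer_cube (q : dyadic n.+1) :
  (lebesgue_outer (cube q : set 'rV[R]_n.+1) <= (side q ^+ n.+1)%:E)%E.
Proof.
pose b : 'rV[R]_n.+1 * 'rV[R]_n.+1 := (\row_i ((q.2 ord0 i)%:~R * side q),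
  \row_i ((q.2 ord0 i + 1)%:~R * side q)).
have -> : cube q = box b.
  by apply/seteqP; split => x /= xq i; move: (xq i); rewrite !mxE.
apply: (le_trans (lebesgue_outer_box b)); rewrite lee_fin /box_volume.
rewrite (eq_bigr (fun=> side q)); last first.
  move=> i _; rewrite !mxE intrD mulrDl addrAC subrr add0r mul1r.
  by rewrite max_r// ltW// side_gt0.
by rewrite prodr_const card_ord.
Qed.

Lemma lebesgue_outer_cubes (D : set (dyadic n.+1)) :
  (lebesgue_outer (\bigcup_(q in D) cube q : set 'rV[R]_n.+1) <=
   \esum_(q in D) (side q ^+ n.+1)%:E)%E.
Proof.
apply: (le_trans (outer_measure_bigcup_esum lebesgue_outer D _)).
by apply: le_esum => q _; exact: lebesgue_outer_cube.
Qed.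

Lemma hcontent_ge0 delta E : (0 <= hcontent delta E)%E.
Proof.
apply: le_ereal_inf_tmp => _ [D _ <-].
by apply: esum_ge0 => q _; rewrite lee_fin powR_ge0.
Qed.

Lemma le_hcontent delta : {homo @hcontent R n.+1 delta : A B / A `<=` B >-> (A <= B)%E}.
Proof.
move=> A B AB; apply/ereal_inf_le_tmp => x [D BD <-{x}].
by exists D => //; exact: subset_trans AB BD.
Qed.

(** A content below 1 admits near-optimal covers of total below 1. Each cube in such a cover has
    side less than 1, so its volume is at most its side to the power [delta]. *)
Lemma lebesgue_outer_le_hcontent (delta : R) E : 0 < delta -> delta <= n.+1%:R ->
  (hcontent delta E < 1)%E -> (lebesgue_outer E <= hcontent delta E)%E.
Proof.
move=> delta0 dn H1; apply/lee_addgt0Pr => e e0.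
have fH : hcontent delta E \is a fin_num.
  by rewrite ge0_fin_numE ?hcontent_ge0// (lt_trans H1)// ltry.
(* The slack [d] must be within the error [e] and also keep the total of the cover below 1. *)
have [d [d0 de d1]] : exists d : R, [/\ 0 < d, d <= e & (hcontent delta E + d%:E < 1)%E].
  move: H1; rewrite -(fineK fH) => H1; set h := fine _ in H1 *.
  rewrite lte_fin in H1.
  exists (Num.min e ((1 - h) / 2)); rewrite lt_min e0/= ge_min lexx; split => //.
    by lra.
  rewrite -EFinD lte_fin; have : Num.min e ((1 - h) / 2) <= (1 - h) / 2.
    by rewrite ge_min lexx orbT.
  by lra.
have [_ [D ED <-] Dd] := lb_ereal_inf_adherent d0 fH.
apply: (@le_trans _ _ (\esum_(q in D) (side q `^ delta)%:E)%E); last first.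
  by apply: (le_trans (ltW Dd)); rewrite leeD2l.
apply: (le_trans (le_lebesgue_outer (subset_trans ED (@interior_subset _ _)))).
apply: (le_trans (lebesgue_outer_cubes D)).
apply: le_esum => q Dq; rewrite lee_fin -powR_mulrn ?(ltW (side_gt0 _))//.
have : side q `^ delta < 1 :> R.
  rewrite -lte_fin; apply: (le_lt_trans _ (lt_trans Dd d1)).
  apply: esum_ge; exists [set q]; first by split => // _ ->.
  by rewrite fsbig_set1.
rewrite ltNge => /negP s1.
have sq1 : side q < 1 :> R.
  rewrite ltNge; apply/negP => q1; apply: s1.
  by rewrite -(powRr0 (side q)); apply: ler_powR => //; exact: ltW.
have q01 : 0 < @side R _ q <= 1 by rewrite side_gt0 ltW.
exact: (ger_powR q01).
Qed.

(** The shifted product is a polynomial in the shift, hence continuous at 0, and [2 ^- k] tends to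
    0. *)
Lemma prod_shift_le (c : 'I_n.+1 -> R) (e : R) : 0 < e ->
  exists k : nat, \prod_i (c i + 4 * 2 ^- k) <= \prod_i c i + e.
Proof.
move=> e0; pose p : {poly R} := \prod_i ((c i)%:P + 4 *: 'X).
have pE t : p.[t] = \prod_i (c i + 4 * t).
  by rewrite horner_prod; apply: eq_bigr => i _; rewrite !hornerE.
have cp : p.[2 ^- k] @[k --> \oo] --> p.[0].
  have h0 : (2 ^- k : R) @[k --> \oo] --> 0.
    under eq_fun do rewrite -exprVn.
    by apply: cvg_expr; rewrite ger0_norm ?invf_lt1// ltr1n.
  by apply: continuous_cvg h0; exact: continuous_horner.
move/cvgrPdist_le : cp => /(_ e e0)[k _ /(_ k (leqnn k))] /= pk.
exists k; rewrite -pE.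
have -> : \prod_i c i = p.[0] by rewrite pE; apply: eq_bigr => i _; lra.
by move: pk; rewrite ler_norml => /andP[+ _]; lra.
Qed.

(* One extra layer of grid cubes on each side puts the box in the interior of
   the union; with rounding this costs at most 4 grid steps per coordinate. *)
Lemma box_grid_cover b (k : nat) : exists D : set (dyadic n.+1),
  box b `<=` (\bigcup_(q in D) cube q)° /\
  (\esum_(q in D) (side q ^+ n.+1 : R)%:E <=
   (\prod_i (Num.max 0 (b.2 ord0 i - b.1 ord0 i) + 4 * 2 ^- k))%:E)%E.
Proof.
have h0 : 0 < (2 ^- k : R) by rewrite invr_gt0 exprn_gt0.
(* A box with a degenerate side is empty, so the empty collection covers it. *)
have [[i bi]|] := pselect (exists i, b.2 ord0 i <= b.1 ord0 i).
  exists set0; split.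
    by move=> x /(_ i) /andP[/le_lt_trans /[apply]]; rewrite ltNge bi.
  rewrite esum_set0 lee_fin; apply: prodr_ge0 => j _.
  by rewrite addr_ge0 ?le_max ?lexx// mulr_ge0// ltW.
move=> /forallNP bne; set h := 2 ^- k in h0 *.
have blt i : b.1 ord0 i < b.2 ord0 i by rewrite ltNge; exact/negP/bne.
(* Along coordinate [i] the cells used run from one before the cell of [b.1] to one after the cell
   of [b.2], both included, hence the [+ 3] in [N i]. *)
pose lo i := Num.floor (b.1 ord0 i / h) - 1.
pose N i := absz (Num.floor (b.2 ord0 i / h) - Num.floor (b.1 ord0 i / h) + 3).
(* A common bound [K] makes the multi-indices a finite type; [family] then restricts coordinate [i]
   to its own [N i] cells. *)
pose K := (\max_i N i)%N.
have flE i : Num.floor (b.1 ord0 i / h) <= Num.floor (b.2 ord0 i / h).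
  by apply: le_floor; rewrite ler_pM2r ?invr_gt0// ltW.
have NE i : (N i)%:Z = Num.floor (b.2 ord0 i / h) - Num.floor (b.1 ord0 i / h) + 3.
  by rewrite /N; have := flE i; lia.
pose e (f : {ffun 'I_n.+1 -> 'I_K}) : dyadic n.+1 :=
  (- (k%:Z), \row_i (lo i + (f i)%:Z)).
have ei : injective e.
  move=> f g [] /rowP fg; apply/ffunP => i; apply/val_inj => /=.
  by move: (fg i); rewrite !mxE => /addrI [].
have sideE f : side (e f) = h :> R by rewrite /side /= -invr_expz.
exists [set e f | f in [set f | f \in family (fun i => [pred j : 'I_K | (j < N i)%N])]].
split.
  (* Moving each coordinate by less than [h] changes its cell by at most one, which the extra layer
     absorbs. *)
  move=> x bx; exists (fun j i => ball (x j i) h) => [j i|y xy].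
    exact: nbhsx_ballx.
  have yb i : b.1 ord0 i / h - 1 < y ord0 i / h < b.2 ord0 i / h + 1.
    move: (xy ord0 i) (bx i); rewrite /ball /= ltr_norml => /andP[y1 y2].
    move=> /andP[x1 x2]; have hh : h / h = 1 by rewrite divff// gt_eqF.
    by rewrite -hh -mulrBl -mulrDl !ltr_pM2r ?invr_gt0//; apply/andP; split; lra.
  pose m i := Num.floor (y ord0 i / h).
  have mE i : lo i <= m i <= Num.floor (b.2 ord0 i / h) + 1.
    have /andP[y1 y2] := yb i; apply/andP; split.
      rewrite /lo /m floor_ge_int intrB lerBlDr.
      by apply: (le_trans (floor_le _)); rewrite -lerBlDr; exact: ltW.
    rewrite -lerBlDr floor_ge_int intrB lerBlDr.
    by apply: (le_trans (floor_le _)); exact: ltW.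
  have mK i : (absz (m i - lo i)%R < K)%N.
    apply: (@leq_trans (N i)); last exact: leq_bigmax.
    by have := NE i; have := mE i; rewrite /lo; lia.
  exists (e [ffun i => Ordinal (mK i)]).
    exists [ffun i => Ordinal (mK i)] => //=.
    apply/familyP => i; rewrite ffunE inE /=.
    by have := NE i; have := mE i; rewrite /lo; lia.
  move=> i; rewrite sideE /= mxE ffunE /=.
  have -> : lo i + (absz (m i - lo i)%R)%:Z = m i by have := mE i; lia.
  have := floor_itv (y ord0 i / h).
  by rewrite ler_pdivlMr// ltr_pdivrMr.
rewrite esum_fin_image//; last first.
  by move=> i; rewrite lee_fin exprn_ge0// ltW// side_gt0.
rewrite (eq_bigr (fun=> (\prod_(i < n.+1) h)%:E)); last first.
  by move=> f _; rewrite sideE prodr_const card_ord.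
rewrite sumEFin lee_fin.
(* The number of cubes times [h ^+ n.+1] factors as the product of the [N i * h], so one coordinate
   can be estimated at a time. *)
rewrite -(bigA_distr_big_dep (fun i => [pred j : 'I_K | (j < N i)%N]) (fun _ _ => h)).
apply: ler_prod => i _; rewrite sumr_ge0/=; last by move=> *; exact: ltW.
have NK : (N i <= K)%N by exact: leq_bigmax.
rewrite (big_ord_narrow NK) sumr_const card_ord max_r ?subr_ge0 ?(ltW (blt i))//.
have NR : (N i)%:R = (N i)%:Z%:~R :> R by [].
rewrite -(mulr_natl h) NR NE.
rewrite -ler_pdivlMr// 2!mulrDl mulNr mulfK ?gt_eqF//.
(* Rounding [b.1 / h] down loses at most 1; with the 3 extra cells this gives the constant 4. *)
have /andP[_] := floor_itv (b.1 ord0 i / h); have := floor_le (b.2 ord0 i / h).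
by rewrite !intrD intrN; lra.
Qed.

(** Each box of a cover is replaced by grid cubes containing it in the interior of their union; the
    [j]-th replacement may cost [e / 2 ^ j.+1], for a total of [e]. *)
Lemma hcontent_le_lebesgue_outer E :
  (hcontent n.+1%:R E <= lebesgue_outer E)%E.
Proof.
apply: le_ereal_inf_tmp => _ [B EB <-].
apply/lee_addgt0Pr => e e0.
have H j : exists D : set (dyadic n.+1),
  box (B j) `<=` (\bigcup_(q in D) cube q)° /\
  (\esum_(q in D) (side q ^+ n.+1 : R)%:E <=
   (box_volume (B j))%:E + (e / (2 ^ j.+1)%:R)%:E)%E.
  have [k Hk] := prod_shift_le (fun i => Num.max 0 ((B j).2 ord0 i - (B j).1 ord0 i))
    (divr_gt0 e0 (ltr0Sn R (2 ^ j.+1).-1)).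
  have [D [D1 D2]] := box_grid_cover (B j) k.
  exists D; split => //; apply: (le_trans D2); rewrite -EFinD lee_fin.
  by move: Hk; rewrite prednK ?expn_gt0.
have [D HD] := choice H.
apply: (@le_trans _ _ (\esum_(q in \bigcup_j D j) (side q `^ n.+1%:R : R)%:E)%E).
  apply: ereal_inf_lbound; exists (\bigcup_j D j) => //=.
  move=> x /EB[j _ /(HD j).1]; apply: filterS => y [q Dq qy].
  by exists q => //; exists j.
apply: (le_trans (le_esum_bigcup _ _)); first by move=> q; rewrite lee_fin powR_ge0.
apply: (le_trans _ (epsilon_trick _ _ _)); last 2 first.
- by move=> j; rewrite lee_fin box_volume_ge0.
- exact: ltW.
apply: lee_nneseries => [j _ _|j _].
  by apply: esum_ge0 => q _; rewrite lee_fin powR_ge0.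
apply: (le_trans _ (HD j).2); apply: le_esum => q _.
by rewrite powR_mulrn ?(ltW (side_gt0 _)).
Qed.

Lemma lebesgue_outer_le_hcontentn E :
  (lebesgue_outer E <= hcontent n.+1%:R E)%E.
Proof.
apply: le_ereal_inf_tmp => _ [D ED <-].
apply: (le_trans (le_lebesgue_outer (subset_trans ED (@interior_subset _ _)))).
apply: (le_trans (lebesgue_outer_cubes D)).
by apply: le_esum => q Dq; rewrite lee_fin powR_mulrn ?(ltW (side_gt0 _)).
Qed.

Lemma hcontentn E : hcontent n.+1%:R E = lebesgue_outer E.
Proof.
by apply/eqP; rewrite eq_le hcontent_le_lebesgue_outer lebesgue_outer_le_hcontentn.
Qed.

End boxes.

(** * Measurable sets, outer regularity and Urysohn approximation *)

Section lebesgue_sigma_algebra.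
Set Implicit Arguments.
Unset Strict Implicit.
Context {R : realType} {n : nat}.
Implicit Types (A E U : set 'rV[R]_n.+1).

Local Notation L := (@lebesgue_outer R n).
Local Notation T := (caratheodory_type L).

(** The hyperplane cuts every box of a cover into two boxes, [B1 k] below and [B2 k] above, whose
    volumes sum to at most the original. The [Num.max 0] in the volume handles boxes lying on one
    side. *)
Lemma caratheodory_halfspace (i : 'I_n.+1) (c : R) :
  measurable ([set x | x ord0 i < c] : set T).
Proof.
apply: le_caratheodory_measurable => X; set A := [set x | _].
apply: le_ereal_inf_tmp => _ [B XB <-].
pose B1 k := ((B k).1,
  \row_j if j == i then Num.min ((B k).2 ord0 j) c else (B k).2 ord0 j).
pose B2 k :=
  (\row_j (if j == i then Num.max ((B k).1 ord0 j) c else (B k).1 ord0 j), (B k).2).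
apply: (@le_trans _ _ (\sum_(k <oo) (box_volume (B1 k))%:E +
    \sum_(k <oo) (box_volume (B2 k))%:E)%E).
  apply: leeD; apply: ereal_inf_lbound.
    exists B1 => // x [/XB[k _ xk] xA]; exists k => // j /=; rewrite !mxE.
    have /andP[x1 x2] := xk j; rewrite x1/=; case: eqP => // ->.
    by rewrite lt_min xA andbT; case/andP: (xk i).
  exists B2 => // x [/XB[k _ xk] xA]; exists k => // j /=; rewrite !mxE.
  have /andP[x1 x2] := xk j; rewrite x2 andbT; case: eqP => // ->.
  rewrite ge_max; case/andP: (xk i) => -> _ /=.
  by rewrite leNgt; apply/negP.
rewrite -nneseriesD; last 2 first.
- by move=> k _ _; rewrite lee_fin box_volume_ge0.
- by move=> k _ _; rewrite lee_fin box_volume_ge0.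
apply: lee_nneseries => [k _ _|k _].
  by rewrite adde_ge0// lee_fin box_volume_ge0.
rewrite -EFinD lee_fin /box_volume.
rewrite (bigD1 i)//= [X in _ + X <= _](bigD1 i)//= [leRHS](bigD1 i)//=.
rewrite !mxE eqxx.
set P := \prod_(j < n.+1 | j != i) Num.max 0 ((B k).2 ord0 j - (B k).1 ord0 j).
have -> : \prod_(j < n.+1 | j != i) Num.max 0 ((B1 k).2 ord0 j - (B1 k).1 ord0 j) = P.
  by apply: eq_bigr => j /negbTE ji; rewrite !mxE ji.
have -> : \prod_(j < n.+1 | j != i) Num.max 0 ((B2 k).2 ord0 j - (B2 k).1 ord0 j) = P.
  by apply: eq_bigr => j /negbTE ji; rewrite !mxE ji.
rewrite -mulrDl ler_wpM2r//.
  by apply: prodr_ge0 => j _; rewrite le_max lexx.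
move: ((B k).1 _ _) ((B k).2 _ _) => a b.
rewrite /Num.min /Num.max; repeat case: ifPn => //; rewrite -?leNgt; lra.
Qed.

Lemma caratheodory_cube (q : dyadic n.+1) : measurable (cube q : set T).
Proof.
have -> : (cube q : set T) = \bigcap_(i in [set: 'I_n.+1])
    ([set x | x ord0 i < (q.2 ord0 i + 1)%:~R * side q] `\`
     [set x | x ord0 i < (q.2 ord0 i)%:~R * side q]).
  apply/seteqP; split => x /= xq i.
    by move=> _; have /andP[a b] := xq i; split=> //=; apply/negP; rewrite -leNgt.
  by have [/= a /negP] := xq i I; rewrite -leNgt a => ->.
apply: fin_bigcap_measurable => // i _.
by apply: measurableD; exact: caratheodory_halfspace.
Qed.

(** An open set is the union of the countably many dyadic cubes inside it: a grid finer than the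
    radius of a ball around a point has a cell that contains the point and stays in the ball. *)
Lemma open_caratheodory U : open U -> measurable (U : set T).
Proof.
move=> oU.
have -> : (U : set T) = \bigcup_(q in [set q : dyadic n.+1 | cube q `<=` U]) cube q.
  apply/seteqP; split => [x Ux|x [q qU]]; last exact: qU.
  have /nbhs_ballP[e /= e0 eU] : nbhs x U by exact: open_nbhs_nbhs.
  have [k ke] : exists k : nat, (2 ^- k : R) < e.
    have h0 : (2 ^- k : R) @[k --> \oo] --> 0.
      under eq_fun do rewrite -exprVn.
      by apply: cvg_expr; rewrite ger0_norm ?invf_lt1// ltr1n.
    move/cvgr0_norm_lt : h0 => /(_ e e0)[k _ /(_ k (leqnn k))] /= h.
    by exists k; rewrite ger0_norm ?invr_ge0 ?exprn_ge0 in h.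
  set h := 2 ^- k in ke; have h0 : 0 < h by rewrite invr_gt0 exprn_gt0.
  pose q : dyadic n.+1 := (- (k%:Z), \row_i Num.floor (x ord0 i / h)).
  have sq : side q = h :> R by rewrite /side /= -invr_expz.
  have xq : cube q x.
    move=> i; rewrite sq mxE /=.
    by have := floor_itv (x ord0 i / h); rewrite ler_pdivlMr// ltr_pdivrMr.
  exists q => //= y yq; apply: eU; split => // i j.
  rewrite (ord1 i) /ball /=.
  move: (xq j) (yq j); rewrite sq mxE /= intrD mulrDl mul1r.
  by rewrite ltr_norml => /andP[? ?] /andP[? ?]; apply/andP; split; lra.
rewrite bigcup_mkcond; apply: countable_bigcupT_measurable => [|q].
  exact: countableP.
by case: ifPn => // _; exact: caratheodory_cube.
Qed.

Lemma continuous_caratheodory (phi : 'rV[R]_n.+1 -> R) : continuous phi ->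
  measurable_fun setT (phi : T -> R).
Proof.
move=> cphi; apply: (measurability (@RGenOInfty.G R)).
  exact: RGenOInfty.measurableE.
move=> _ [_ [r ->] <-]; rewrite setTI; apply: open_caratheodory.
by apply: open_comp => // x _; exact: cphi.
Qed.

(** Intersecting with the boxes [C m] makes the outer measure finite, hence cancellable. For each
    piece the open set is the interior of the union of a near-optimal dyadic cover, available
    because the content equals the outer measure. *)
Lemma outer_regular A (e : R) : 0 < e -> measurable (A : set T) ->
  exists U, [/\ open U, A `<=` U & (L (U `\` A) <= e%:E)%E].
Proof.
move=> e0 mA.
pose B m : 'rV[R]_n.+1 * 'rV[R]_n.+1 := (const_mx (- m%:R), const_mx (m%:R)).
pose C m : set 'rV[R]_n.+1 := box (B m).
have mC m : measurable (C m : set T).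
  have -> : (C m : set T) = \bigcap_(i in [set: 'I_n.+1])
    ([set x | x ord0 i < m%:R] `\` [set x | x ord0 i < - m%:R]).
    apply/seteqP; split => x /= xq i.
      move=> _; have /andP[] := xq i; rewrite !mxE => a b.
      by split=> //=; apply/negP; rewrite -leNgt.
    by have [/= a /negP] := xq i I; rewrite -leNgt !mxE a => ->.
  apply: fin_bigcap_measurable => // i _.
  by apply: measurableD; exact: caratheodory_halfspace.
have H m : exists U, [/\ open U, A `&` C m `<=` U &
    (L (U `\` (A `&` C m)) <= (e / (2 ^ m.+1)%:R)%:E)%E].
  set D := A `&` C m.
  have mD : measurable (D : set T) by exact: measurableI.
  have fD : L D \is a fin_num.
    rewrite ge0_fin_numE ?lebesgue_outer_ge0//.
    apply: (@le_lt_trans _ _ (box_volume (B m))%:E); last exact: ltry.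
    apply: (le_trans _ (lebesgue_outer_box _)); apply: le_lebesgue_outer.
    exact: subIsetr.
  have em : 0 < e / (2 ^ m.+1)%:R by rewrite divr_gt0// ltr0n expn_gt0.
  have := fD; rewrite -hcontentn => fD'.
  have [_ [Q DQ <-] Qlt] := lb_ereal_inf_adherent em fD'.
  pose U : set 'rV[R]_n.+1 := (\bigcup_(q in Q) cube q)°.
  have {}DQ : D `<=` U by [].
  exists U; split => //; first exact: open_interior.
  have LU : (L U <= L D + (e / (2 ^ m.+1)%:R)%:E)%E.
    rewrite -(hcontentn D); apply: (le_trans _ (ltW Qlt)).
    apply: (le_trans (le_lebesgue_outer (@interior_subset _ _))).
    apply: (le_trans (lebesgue_outer_cubes Q)).
    by apply: le_esum => q Qq; rewrite lee_fin powR_mulrn ?(ltW (side_gt0 _)).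
  (* Caratheodory's condition for [D] splits [L U] into [L D] and the excess; the finite [L D]
     cancels. *)
  move: LU; have -> := mD U; rewrite (setIidr DQ) -setDE.
  by rewrite leeD2lE.
have [U HU] := choice H.
exists (\bigcup_m U m); split.
- by apply: bigcup_open => m _; have [] := HU m.
- move=> x Ax.
  pose m := (\max_(i < n.+1) (Num.truncn (`|x ord0 i|)).+1)%N.
  exists m => //; have [_ + _] := HU m; apply; split => // i.
  rewrite !mxE; have xm : `|x ord0 i| < m%:R.
    apply: (lt_le_trans (truncnS_gt _)); rewrite ler_nat.
    exact: (leq_bigmax (F := fun i => (Num.truncn (`|x ord0 i|)).+1)).
  by move: xm; rewrite ltr_norml => /andP[/ltW -> ->].
apply: (@le_trans _ _ (L (\bigcup_m (U m `\` (A `&` C m))))).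
  apply: le_lebesgue_outer => x [[m _ Um] Ax]; exists m => //.
  by split => // -[].
apply: (le_trans (lebesgue_outer_sigma_subadditive _)).
apply: (@le_trans _ _ (\sum_(m <oo) (e / (2 ^ m.+1)%:R)%:E)%E).
  by apply: lee_nneseries => [m _ _|m _]; [exact: lebesgue_outer_ge0|case: (HU m)].
by apply: (epsilon_trick0 xpredT); exact: ltW.
Qed.

(** Take open [U] around [A] and [V] around its complement, each with small excess. A Urysohn
    function that is 0 off [U] and 1 off [V] can differ from the indicator only on the two excess
    sets. *)
Lemma indicator_approx A (e : R) : 0 < e -> measurable (A : set T) ->
  exists (phi : 'rV[R]_n.+1 -> R) (E : set 'rV[R]_n.+1),
  [/\ continuous phi, forall x, 0 <= phi x <= 1, (L E <= e%:E)%E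
    & forall x, ~ E x -> phi x = \1_A x].
Proof.
move=> e0 mA; have e20 : 0 < e / 2 by rewrite divr_gt0.
have [U [oU AU LU]] := outer_regular e20 mA.
have [V [oV AV LV]] := outer_regular e20 (measurableC mA).
have sep : uniform_separator (~` U) (~` V).
  apply: (normal_separatorP (R := R) (T := 'rV[R]_n.+1)).1.
  - exact: pseudometric_normal.
  - exact: open_closedC.
  - exact: open_closedC.
  (* The closed sets are disjoint because [U] and [V] together cover the space. *)
  - rewrite -setCU -[RHS]setCT; congr (~` _); apply/seteqP; split=> // x _.
    by have [/AU|/AV] := pselect (A x); [left|right].
pose phi : 'rV[R]_n.+1 -> R := Urysohn (~` U) (~` V).
exists phi, ((U `\` A) `|` (V `\` ~` A)); split.
- exact: Urysohn_continuous.
- move=> x; have := @Urysohn_range _ R (~` U) (~` V) (phi x) (ex_intro2 _ _ x I erefl).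
  by rewrite /= in_itv.
- apply: (le_trans (outer_measureU2 L _ _)).
  by rewrite [leRHS](_ : _ = (e / 2)%:E + (e / 2)%:E)%E ?leeD// -EFinD -splitr.
- move=> x /not_orP[xU xV]; rewrite indicE.
  have [Ax|Ax] := pselect (A x).
    rewrite mem_set//; apply: (Urysohn_sub1 sep); exists x => // Vx.
    by apply: xV; split => // /(_ Ax).
  rewrite memNset//; apply: (Urysohn_sub0 sep); exists x => // Ux.
  exact: xU.
Qed.

End lebesgue_sigma_algebra.

(** * Monotone integrands and Chebyshev's inequality *)

Section choquet_facts.
Set Implicit Arguments.
Unset Strict Implicit.
Context {R : realType}.

(** Superlevel sets of a monotone function are intervals. *)
Lemma nonincreasing_emeasurable (D : set R) (h : R -> \bar R) :
  measurable D -> {homo h : s t / s <= t >-> (t <= s)%E} ->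
  measurable_fun D h.
Proof.
move=> mD hni; apply: (measurability _ (ErealGenOInfty.measurableE R)).
move=> _ [_ [r ->] <-]; apply: measurableI => //.
apply: is_interval_measurable => s t /=.
rewrite !in_itv/= !andbT => hs ht u /andP[su ut].
by rewrite in_itv/= andbT (lt_le_trans ht)// hni.
Qed.

Context {n : nat}.
Implicit Types (delta t : R) (g : 'rV[R]_n.+1 -> \bar R).

Lemma choquet_integrand_nonincreasing delta g :
  {homo (fun t => hcontent delta [set x | [set: 'rV[R]_n.+1] x /\ (t%:E < g x)%E])
    : s t / s <= t >-> (t <= s)%E}.
Proof.
move=> s t st; apply: le_hcontent => x [_ tg]; split => //.
by apply: le_lt_trans tg; rewrite lee_fin.
Qed.

(** On [[0, t]] the nonincreasing integrand is at least its value at [t]. *)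
Lemma choquet_chebyshev delta g t : 0 <= t ->
  (t%:E * hcontent delta [set x | t%:E < g x] <= choquet delta setT g)%E.
Proof.
move=> t0; set h := hcontent _ _.
have mg : measurable_fun (`[0, +oo[ : set R) (fun t => hcontent delta
    [set x | [set: 'rV[R]_n.+1] x /\ (t%:E < g x)%E]).
  by apply: nonincreasing_emeasurable => //; exact: choquet_integrand_nonincreasing.
have hE : h = hcontent delta [set x | [set: 'rV[R]_n.+1] x /\ (t%:E < g x)%E].
  by congr hcontent; apply/seteqP; split => [x ? //|x []].
apply: (@le_trans _ _ (\int[lebesgue_measure]_(s in `[0%R, t]) cst h s)%E).
  rewrite integral_cst//= lebesgue_measure_itv /= lte_fin muleC.
  move: t0; rewrite le_eqVlt => /predU1P[<-|->]; last by rewrite oppr0 adde0.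
  by rewrite ltxx.
apply: (@le_trans _ _ (\int[lebesgue_measure]_(s in `[0%R, t])
    hcontent delta [set x | [set: 'rV[R]_n.+1] x /\ (s%:E < g x)%E])%E).
  apply: ge0_le_integral => //.
  - by move=> s _; rewrite /cst hcontent_ge0.
  - by apply: nonincreasing_emeasurable => //; exact: choquet_integrand_nonincreasing.
  - move=> s /=; rewrite in_itv/= => /andP[s0 st]; rewrite hE.
    exact: choquet_integrand_nonincreasing.
apply: ge0_subset_integral => //.
  by move=> *; exact: hcontent_ge0.
by move=> s /=; rewrite !in_itv/= andbT => /andP[].
Qed.

End choquet_facts.

(** * Borel-Cantelli and null sets for outer measures *)

Section borel_cantelli.
Set Implicit Arguments.
Unset Strict Implicit.

(** The limit superior lies in every tail union, whose outer measure is at most a tail of a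
    convergent series. *)
Lemma outer_measure_lim_sup_set0 (R : realType) (T : Type)
    (mu : {outer_measure set T -> \bar R}) (A : (set T)^nat) :
  (\sum_(k <oo) mu (A k) < +oo)%E -> mu (lim_sup_set A) = 0%E.
Proof.
move=> Aoo; apply/eqP; rewrite eq_le outer_measure_ge0 andbT.
apply: (cvge_ge (nearW _ _) (nneseries_tail_cvg Aoo _)) => [m|k _]; last first.
  exact: outer_measure_ge0.
apply: le_trans (outer_measure_sigma_subadditive_tail mu m A).
apply: le_outer_measure => x /(_ m I)[k /= mk Akx]; exists k => //=.
by apply/negP; rewrite -leqNgt.
Qed.

Lemma caratheodory_null (R : realType) (T : Type)
    (mu : {outer_measure set T -> \bar R}) (A : set T) :
  mu A = 0%E -> mu.-caratheodory A.
Proof.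
move=> A0; apply: le_caratheodory_measurable => X.
have -> : mu (X `&` A) = 0%E.
  apply/eqP; rewrite eq_le outer_measure_ge0 andbT -A0.
  by apply: le_outer_measure; exact: subIsetr.
by rewrite add0e; apply: le_outer_measure; exact: subIsetl.
Qed.

End borel_cantelli.

(** * Limits of continuous functions are measurable *)

Section limit_of_continuous.
Context (R : realType) (n : nat).

Lemma NL1_limit_measurable (delta : R) (f : 'rV[R]_n.+1 -> \bar R) :
  0 < delta -> delta <= n.+1%:R ->
  NL1_limit_of_continuous delta f -> lebesgue_measurable f.
Proof.
move=> delta0 deltan [phi [cphi phif]].
(* With this squared bound, Chebyshev at level [2 ^- k.+1] leaves content at most [2 ^- k.+1]. The
   shifted exponent keeps it below 1, where content dominates outer measure. *)
have H k : exists i, (choquet delta setT (fun x => `|f x - (phi i x)%:E|) <=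
    (2 ^- k.+1 * 2 ^- k.+1)%:E)%E.
  have k0 : 0 < 2 ^- k.+1 * 2 ^- k.+1 :> R.
    by rewrite mulr_gt0// invr_gt0 exprn_gt0.
  case/fine_cvgP : phif => -[p _ fp] /cvgr0_norm_le /(_ _ k0)[m _ mP].
  exists (maxn p m); have /= := mP _ (leq_maxr p m).
  by move=> /(le_trans (ler_norm _)); rewrite -lee_fin fineK// (fp _ (leq_maxl _ _)).
have [s Hs] := choice H.
pose A k : set 'rV[R]_n.+1 := [set x | ((2 ^- k.+1)%:E < `|f x - (phi (s k) x)%:E|)%E].
have LA k : (lebesgue_outer (A k) <= (2 ^- k.+1)%:E)%E.
  have k0 : 0 < 2 ^- k.+1 :> R by rewrite invr_gt0 exprn_gt0.
  have hA : (hcontent delta (A k) <= (2 ^- k.+1)%:E)%E.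
    have := le_trans (choquet_chebyshev _ _ (ltW k0)) (Hs k).
    by rewrite EFinM lee_pmul2l// lte_fin.
  apply: (le_trans _ hA); apply: (lebesgue_outer_le_hcontent delta0 deltan).
  apply: (le_lt_trans hA); rewrite lte_fin invf_lt1 ?exprn_gt0//.
  by rewrite exprn_egt1// ltr1n.
have LN : lebesgue_outer (lim_sup_set A) = 0%E.
  apply: outer_measure_lim_sup_set0.
  apply: (@le_lt_trans _ _ 1%E); last exact: ltry.
  apply: le_trans (epsilon_trick0 xpredT (@ler01 R)).
  apply: lee_nneseries => [k _ _|k _]; first exact: lebesgue_outer_ge0.
  by apply: (le_trans (LA k)); rewrite mul1r natrX.
(* The upper limit [g] is measurable whether or not the subsequence converges; [f] agrees with it
   off a null set, and completeness transfers measurability. *)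
pose g x := limn_esup (fun k => (phi (s k) x)%:E).
have mg : lebesgue_measurable g.
  apply: measurable_fun_limn_esup => k; apply/measurable_EFinP.
  exact: continuous_caratheodory.
have cmu := @measure_is_complete_caratheodory R _ (@lebesgue_outer R n).
apply: (@ae_measurable_fun _ _ R _ cmu setT g f); last exact: mg.
exists (lim_sup_set A); split => //.
  exact: caratheodory_null.
move=> x /= fgx; apply: contrapT => Nx; apply: fgx => _.
have [m Hm] : exists m, forall k, (m <= k)%N ->
    (`|f x - (phi (s k) x)%:E| <= (2 ^- k.+1)%:E)%E.
  apply: contrapT => /forallNP Hm; apply: Nx => m _.
  have /existsNP[k /not_implyP[mk Hk]] := Hm m; exists k => //.
  by rewrite /A /= ltNge; exact/negP.
(* An infinite value would be at infinite distance from every real number. *)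
have ffin : f x \is a fin_num.
  have := Hm m (leqnn m); case: (f x) => [r| |] //=.
rewrite /g; move: Hm; rewrite -(fineK ffin); set r := fine _ => Hm.
have cr : phi (s k) x @[k --> \oo] --> r.
  have h0 : (2 ^- k.+1 : R) @[k --> \oo] --> 0.
    rewrite (cvg_shiftS (fun k => 2 ^- k : R)).
    under eq_fun do rewrite -exprVn.
    by apply: cvg_expr; rewrite ger0_norm ?invf_lt1// ltr1n.
  apply/cvgrPdist_le => e e0.
  move/cvgr0_norm_le : h0 => /(_ _ e0)[p _ hp].
  exists (maxn m p) => // k /=; rewrite geq_max => /andP[mk pk].
  have := Hm k mk; rewrite -EFinB abse_EFin lee_fin => /le_trans; apply.
  by apply: le_trans (hp k pk); exact: ler_norm.
have cE : (phi (s k) x)%:E @[k --> \oo] --> r%:E.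
  by apply: cvg_EFin => //; exact: nearW.
by rewrite is_cvg_limn_esupE; [exact/cvg_lim|exact: cvgP cE].
Qed.

End limit_of_continuous.

(** * Halving the variable in an integral *)

Section scaling.
Set Implicit Arguments.
Unset Strict Implicit.
Context {R : realType}.
Local Notation leb := (@lebesgue_measure R).

(** Pushing Lebesgue measure forward along halving doubles it, as checked on half-open intervals; so
    half of the pushforward is Lebesgue measure, by uniqueness. *)
Lemma ge0_integral_half (h : R -> \bar R) :
  measurable_fun (`]0, +oo[ : set R) h -> (forall t, 0 <= h t)%E ->
  (\int[leb]_(t in `]0%R, +oo[) h (t / 2)%R =
   2%:E * \int[leb]_(t in `]0%R, +oo[) h t)%E.
Proof.
move=> mh h0.
have mphi : measurable_fun [set: measurableTypeR R]
    ((fun t : R => t / 2) : measurableTypeR R -> measurableTypeR R).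
  exact: measurable_funM.
pose phi := (fun t : R => t / 2) : measurableTypeR R -> measurableTypeR R.
pose pm : {measure set (measurableTypeR R) -> \bar R} :=
  measure_function_pushforward__canonical__measure_function_Measure leb mphi.
have half0 : 0 <= 2^-1 :> R by rewrite invr_ge0.
pose nu : {measure set (measurableTypeR R) -> \bar R} := mscale (NngNum half0) pm.
have lebE A : measurable A -> leb A = nu A.
  apply: lebesgue_measure_unique => _ [[a b] _ <-].
  rewrite /nu /= /mscale /= /pushforward /=.
  have -> : (fun t : R => t / 2) @^-1` `]a, b] = `]2 * a, 2 * b]%classic.
    apply/seteqP; split => t /=; rewrite !in_itv/= => /andP[? ?];
      by apply/andP; split; lra.
  rewrite !lebesgue_measure_itv /= !lte_fin ltr_pM2l//.
  case: ifPn => _; last by rewrite mule0.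
  by rewrite -!EFinB -EFinM; congr EFin; lra.
have -> : (\int[leb]_(t in `]0%R, +oo[) h t = \int[nu]_(t in `]0%R, +oo[) h t)%E.
  by apply: eq_measure_integral => A mA _; exact: lebE.
rewrite ge0_integral_mscale//= muleA -EFinM divff// mul1e.
rewrite ge0_integral_pushforward//.
congr integral.
by apply/seteqP; split => t /=; rewrite !in_itv/= !andbT; lra.
Qed.

End scaling.

(** * Rounding to a finite grid *)

Section staircase.
Set Implicit Arguments.
Unset Strict Implicit.
Context {R : realType}.
Implicit Types (e : R) (N : nat) (y : \bar R) (r : R).

(** For [0 < e] and [0 <= y], [e * staircase e N y] is [y] rounded down to a multiple of [e] and
    capped at [N * e]. As a sum over thresholds it can be approximated one level set at a time. *)
Definition staircase e N y : R :=
  \sum_(j < N) ((j.+1%:R * e)%:E <= y)%E%:R.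

Lemma staircase_ge0 e N y : 0 <= staircase e N y.
Proof. by apply: sumr_ge0 => j _; rewrite ler0n. Qed.

Lemma staircase_leN e N y : staircase e N y <= N%:R.
Proof.
rewrite (le_trans (ler_sum _ (G := fun=> 1) _))//.
  by move=> j _; rewrite lern1 leq_b1.
by rewrite sumr_const card_ord.
Qed.

Lemma staircase_le0 e N y : 0 < e -> (y <= 0)%E -> staircase e N y = 0.
Proof.
move=> e0 y0; apply: big1 => j _; case: (leP (j.+1%:R * e)%:E y) => // jy.
by have := le_trans jy y0; rewrite lee_fin leNgt mulr_gt0.
Qed.

Lemma staircase_top e N y : 0 < e -> ((N%:R * e)%:E <= y)%E ->
  staircase e N y = N%:R.
Proof.
move=> e0 Ny; rewrite /staircase (eq_bigr (fun=> 1)).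
  by rewrite sumr_const card_ord.
by move=> j _; rewrite (le_trans _ Ny)// lee_fin ler_pM2r// ler_nat ltn_ord.
Qed.

Lemma staircase_le e N r : 0 < e -> 0 <= r -> e * staircase e N r%:E <= r.
Proof.
move=> e0 r0; elim: N => [|N IH]; first by rewrite /staircase big_ord0 mulr0.
rewrite /staircase big_ord_recr/= -/(staircase e N r%:E) lee_fin.
case: (leP (N.+1%:R * e) r) => Nr /=; last by rewrite mulr0n addr0.
rewrite mulr1n.
apply: le_trans Nr; rewrite mulrC ler_pM2r// -natr1 lerD2r.
exact: staircase_leN.
Qed.

Lemma staircase_ge e N r : 0 < e -> r <= N%:R * e ->
  r - e <= e * staircase e N r%:E.
Proof.
move=> e0; elim: N => [|N IH].
  by rewrite mul0r /staircase big_ord0 mulr0; lra.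
move=> rN; rewrite /staircase big_ord_recr/= -/(staircase e N r%:E) lee_fin.
have [Nr|Nr] := leP r (N%:R * e).
  by apply: (le_trans (IH Nr)); rewrite ler_pM2l// lerDl ler0n.
rewrite staircase_top//; last by rewrite lee_fin ltW.
apply: (@le_trans _ _ (e * N%:R)); last by rewrite ler_pM2l// lerDl ler0n.
by rewrite lerBlDr; apply: (le_trans rN); rewrite -natr1 mulrDl mul1r mulrC.
Qed.

(** For finite [y] only the staircase matching its sign can be nonzero, and rounding towards 0 never
    overshoots. For infinite [y] the first claim is trivial and the second vacuous. *)
Lemma staircase_dist e N y : 0 < e ->
  (`|y - (e * (staircase e N y - staircase e N (- y)))%:E| <= `|y|)%E /\
  ((`|y| <= (N%:R * e)%:E)%E ->
   (`|y - (e * (staircase e N y - staircase e N (- y)))%:E| <= e%:E)%E).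
Proof.
move=> e0; case: y => [r| |]; last 2 first.
- by split; [exact: leey|rewrite leNgt ltry].
- by split; [exact: leey|rewrite leNgt ltry].
rewrite -!EFinN -EFinB !abse_EFin !lee_fin.
have [r0|r0] := leP 0 r.
  rewrite (@staircase_le0 _ _ (- r)%:E) ?lee_fin ?oppr_le0// subr0.
  have s1 := staircase_le N e0 r0; have s0 : 0 <= e * staircase e N r%:E.
    by rewrite mulr_ge0 ?staircase_ge0// ltW.
  rewrite !ger0_norm ?subr_ge0//; split; first by rewrite gerBl.
  by move=> /(staircase_ge e0); lra.
rewrite (@staircase_le0 _ _ r%:E) ?lee_fin ?(ltW r0)// sub0r mulrN opprK.
have nr0 : 0 <= - r by rewrite oppr_ge0 ltW.
have s1 := staircase_le N e0 nr0; have s0 : 0 <= e * staircase e N (- r)%:E.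
  by rewrite mulr_ge0 ?staircase_ge0// ltW.
rewrite !ler0_norm ?(ltW r0)//; last by lra.
split; first by lra.
by move=> /(staircase_ge e0); lra.
Qed.

End staircase.

(** * Continuous approximation of the staircase *)

Section continuous_approximation.
Set Implicit Arguments.
Unset Strict Implicit.
Context {R : realType} {n : nat}.
Local Notation L := (@lebesgue_outer R n).

(** The error [eta] is split evenly between [f] and [- f], then geometrically over the levels. The
    bound on [phi] holds even on [E], since each [psi j - chi j] lies between -1 and 1. *)
Lemma staircase_approx (f : 'rV[R]_n.+1 -> \bar R) (e eta : R) (N : nat) :
  0 < e -> 0 < eta -> lebesgue_measurable f ->
  exists (phi : 'rV[R]_n.+1 -> R) (E : set 'rV[R]_n.+1),
  [/\ continuous phi, forall x, `|phi x| <= N%:R * e, (L E <= eta%:E)%E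
    & forall x, ~ E x ->
        phi x = e * (staircase e N (f x) - staircase e N (- f x)%E)].
Proof.
move=> e0 eta0 mf.
have approx (g : 'rV[R]_n.+1 -> \bar R) : lebesgue_measurable g ->
  exists psi : nat -> 'rV[R]_n.+1 -> R, exists E : set 'rV[R]_n.+1,
  [/\ forall j, continuous (psi j), forall j x, 0 <= psi j x <= 1,
    (L E <= (eta / 2)%:E)%E
    & forall x, ~ E x -> \sum_(j < N) psi j x = staircase e N (g x)].
  move=> mg.
  pose A j : set 'rV[R]_n.+1 := [set x | ((j.+1%:R * e)%:E <= g x)%E].
  have H j : exists phiE : ('rV[R]_n.+1 -> R) * set 'rV[R]_n.+1,
    [/\ continuous phiE.1, forall x, 0 <= phiE.1 x <= 1,
      (L phiE.2 <= (eta / 2 / (2 ^ j.+1)%:R)%:E)%E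
      & forall x, ~ phiE.2 x -> phiE.1 x = \1_(A j) x].
    have ej : 0 < eta / 2 / (2 ^ j.+1)%:R.
      by rewrite !divr_gt0// ltr0n expn_gt0.
    have mA : measurable (A j : set (caratheodory_type L)).
      rewrite -[A j]setTI; apply: emeasurable_fun_c_infty => //.
    have [phi [E ?]] := indicator_approx ej mA.
    by exists (phi, E).
  have [psi Hpsi] := choice H.
  exists (fun j => (psi j).1), (\bigcup_j (psi j).2); split.
  - by move=> j; have [] := Hpsi j.
  - by move=> j; have [] := Hpsi j.
  - apply: (le_trans (lebesgue_outer_sigma_subadditive _)).
    apply: (@le_trans _ _ (\sum_(j <oo) (eta / 2 / (2 ^ j.+1)%:R)%:E)%E).
      by apply: lee_nneseries => [j _ _|j _]; [exact: lebesgue_outer_ge0|case: (Hpsi j)].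
    by apply: (epsilon_trick0 xpredT); rewrite divr_ge0// ltW.
  - move=> x xE; apply: eq_bigr => j _; have [_ _ _ ->] := Hpsi j.
      rewrite indicE; congr (_%:R); congr nat_of_bool.
      by apply/idP/idP => [/set_mem//|?]; exact/mem_set.
    by move=> Ex; apply: xE; exists j.
have [psi [E [cpsi psi01 LE psiE]]] := approx f mf.
have mNf : lebesgue_measurable (fun x => - f x)%E by exact: measurableT_comp mf.
have [chi [F [cchi chi01 LF chiF]]] := approx _ mNf.
have csum m : continuous (fun x => \sum_(j < m) (psi j x - chi j x)).
  elim: m => [|m IH].
    have -> : (fun x => \sum_(j < 0) (psi j x - chi j x)) = cst 0.
      by apply/funext => y; rewrite big_ord0.
    exact: cst_continuous.
  have -> : (fun x => \sum_(j < m.+1) (psi j x - chi j x)) =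
      (fun x => \sum_(j < m) (psi j x - chi j x)) \+ (psi m \- chi m).
    by apply/funext => y; rewrite big_ord_recr.
  by move=> x; exact: (cvgD (IH x) (cvgB (cpsi m x) (cchi m x))).
exists (fun x => e * \sum_(j < N) (psi j x - chi j x)), (E `|` F); split.
- by move=> x; exact: (cvgM (cvg_cst e) (csum N x)).
- move=> x; rewrite normrM gtr0_norm// mulrC ler_pM2r//.
  apply: (le_trans (ler_norm_sum _ _ _)).
  rewrite (le_trans (ler_sum _ (G := fun=> 1) _))//.
    move=> j _; rewrite ler_norml.
    by move: (psi01 j x) (chi01 j x) => /andP[? ?] /andP[? ?]; apply/andP; split; lra.
  by rewrite sumr_const card_ord.
- apply: (le_trans (outer_measureU2 L _ _)).
  by rewrite [leRHS](_ : _ = (eta / 2)%:E + (eta / 2)%:E)%E ?leeD// -EFinD -splitr.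
- by move=> x /not_orP[xE xF]; rewrite sumrB psiE// chiF.
Qed.

End continuous_approximation.

(** * Measurable functions are limits when [delta] is the dimension *)

Section limit_of_measurable.
Set Implicit Arguments.
Unset Strict Implicit.
Context {R : realType} {n : nat}.
Local Notation L := (@lebesgue_outer R n).
Local Notation leb := (@lebesgue_measure R).
Implicit Types (f : 'rV[R]_n.+1 -> \bar R).

(* Let phi be the staircase approximation of f with step e and height M, exact
   off E.  Off E, |f - phi| <= |f|, and |f - phi| > e forces |f| > M.  On E, where
   |phi| <= M, the bound |f - phi| > t >= 2M still forces |f| > t/2. Hence
   {|f - phi| > t} lies in {|f| > level_shift M e t}, up to E when t <= 2M. *)
Definition level_shift (M e t : R) : R :=
  if t < e then t / 2 else Num.max M (t / 2).

Lemma level_shift_homo M e : {homo level_shift M e : s t / s <= t}.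
Proof.
move=> s t st; rewrite /level_shift.
have st2 : s / 2 <= t / 2 by rewrite ler_pM2r.
case: ifPn => [se|]; case: ifPn => // te.
- by rewrite le_max st2 orbT.
- by rewrite -leNgt => es; have := lt_le_trans te (le_trans es st); rewrite ltxx.
- by move=> _; rewrite ge_max !le_max lexx st2 orbT.
Qed.

Lemma level_shift_ge M e t : t / 2 <= level_shift M e t.
Proof. by rewrite /level_shift; case: ifPn => // _; rewrite le_max lexx orbT. Qed.

Lemma superlevel_approx f (phi : 'rV[R]_n.+1 -> R) (E : set 'rV[R]_n.+1)
    (N : nat) (e eta t : R) :
  0 < e -> 0 <= t -> (forall x, `|phi x| <= N%:R * e) -> (L E <= eta%:E)%E ->
  (forall x, ~ E x ->
     phi x = e * (staircase e N (f x) - staircase e N (- f x)%E)) ->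
  (L [set x | t%:E < `|f x - (phi x)%:E|] <=
   L [set x | (level_shift (N%:R * e) e t)%:E < `|f x|] +
   (cst eta%:E \_ `[0%R, (2 * (N%:R * e))%R]) t)%E.
Proof.
move=> e0 t0 phiN LE phiE; set M := N%:R * e.
have M0 : 0 <= M by rewrite mulr_ge0// ltW.
have offE x : ~ E x -> (t%:E < `|f x - (phi x)%:E|)%E ->
    ((level_shift M e t)%:E < `|f x|)%E.
  move=> xE; rewrite (phiE _ xE) => tx.
  have [d1 d2] := staircase_dist N (f x) e0.
  have tf := lt_le_trans tx d1; rewrite /level_shift.
  case: ifPn => [_|]; first by apply: le_lt_trans tf; rewrite lee_fin; lra.
  rewrite -leNgt => et.
  rewrite /Num.max; case: ifP => _.
    by apply: le_lt_trans tf; rewrite lee_fin; lra.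
  (* If [|f x|] were at most [M], the rounding error would be at most [e], hence at most [t]. *)
  rewrite ltNge; apply/negP => /d2 fe.
  by have := lt_le_trans tx fe; rewrite lte_fin ltNge et.
rewrite /patch; case: ifPn => tM.
  apply: (@le_trans _ _ (L ([set x | (level_shift M e t)%:E < `|f x|]%E `|` E))).
    apply: le_lebesgue_outer => x /= tx.
    by have [Ex|/offE h] := pselect (E x); [right|left; exact: h].
  by apply: (le_trans (outer_measureU2 L _ _)); rewrite leeD2l.
rewrite adde0; apply: le_lebesgue_outer => x /= tx.
have [Ex|/offE] := pselect (E x); last exact.
have {tM} tM : 2 * M < t.
  move: tM; apply: contraNT; rewrite -leNgt => tM.
  by apply/mem_set; rewrite /= in_itv/= t0.
have := phiN x; rewrite -/M; move: tx; case: (f x) => [r| |]; rewrite ?ltry//.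
rewrite -EFinB !abse_EFin !lte_fin => tr phiM.
(* As [2 * M < t], this makes [|r|] exceed both [t / 2] and [M]. *)
have {}tr : t < `|r| + M.
  by apply: (lt_le_trans tr); apply: (le_trans (ler_normB _ _)); rewrite lerD2l.
rewrite /level_shift; case: ifP => _; first by lra.
by rewrite gt_max; apply/andP; split; lra.
Qed.

Lemma measurable_NL1_limit f : NL1 n.+1%:R setT f -> lebesgue_measurable f ->
  NL1_limit_of_continuous n.+1%:R f.
Proof.
move=> fNL1 mf.
pose h (t : R) := L [set x | (t%:E < `|f x|)%E].
have h0 t : (0 <= h t)%E by exact: lebesgue_outer_ge0.
have hni : {homo h : s t / s <= t >-> (t <= s)%E}.
  move=> s t st; apply: le_lebesgue_outer => x /=.
  by apply: le_lt_trans; rewrite lee_fin.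
have mh D : measurable D -> measurable_fun D h.
  by move=> mD; exact: nonincreasing_emeasurable.
(* Dropping the endpoint 0 leaves only positive [t], for which the bound [C / t] makes sense. *)
have choquetE g : choquet n.+1%:R setT g =
    (\int[leb]_(t in `]0%R, +oo[) L [set x | t%:E < g x])%E.
  rewrite integral_itv_obnd_cbnd.
    apply: eq_integral => t _; rewrite hcontentn.
    by congr L; apply/seteqP; split => [x []//|x].
  apply: nonincreasing_emeasurable => // s t st.
  by apply: le_lebesgue_outer => x /=; apply: le_lt_trans; rewrite lee_fin.
pose C := fine (choquet n.+1%:R setT (fun x => `|f x|)%E).
have CE : choquet n.+1%:R setT (fun x => `|f x|)%E = C%:E.
  rewrite fineK// ge0_fin_numE//; apply: integral_ge0 => t _.
  exact: hcontent_ge0.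
have C0 : 0 <= C.
  by rewrite -lee_fin -CE; apply: integral_ge0 => t _; exact: hcontent_ge0.
have hC t : 0 < t -> (h t <= (C / t)%:E)%E.
  move=> t0; rewrite EFinM lee_pdivlMr// muleC -CE /h -hcontentn.
  exact/choquet_chebyshev/ltW.
(* With [i.+1 ^ 2] steps of size [e i] the height [M i] is [i.+1]. An exceptional set of measure at
   most [e i * e i], counted for [t] up to [2 * M i], costs at most [2 * e i]. *)
pose e i : R := i.+1%:R^-1.
have e0 i : 0 < e i by rewrite invr_gt0.
pose M i : R := (i.+1 ^ 2)%:R * e i.
have ME i : M i = i.+1%:R.
  by rewrite /M /e natrX expr2 mulfK.
have H i : exists phiE : ('rV[R]_n.+1 -> R) * set 'rV[R]_n.+1,
  [/\ continuous phiE.1, forall x, `|phiE.1 x| <= M i,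
   (L phiE.2 <= (e i * e i)%:E)%E
    & forall x, ~ phiE.2 x -> phiE.1 x = e i *
       (staircase (e i) (i.+1 ^ 2) (f x) - staircase (e i) (i.+1 ^ 2) (- f x)%E)].
  have [phi [E ?]] := staircase_approx (i.+1 ^ 2) (e0 i) (mulr_gt0 (e0 i) (e0 i)) mf.
  by exists (phi, E).
have [phiE HphiE] := choice H.
exists (fun i => (phiE i).1); split; first by move=> i; have [] := HphiE i.
pose p i t := h (level_shift (M i) (e i) t).
have mp i D : measurable D -> measurable_fun D (p i).
  move=> mD; apply: nonincreasing_emeasurable => // s t st.
  exact/hni/level_shift_homo.
have bound i : (choquet n.+1%:R setT (fun x => `|f x - ((phiE i).1 x)%:E|) <=
    \int[leb]_(t in `]0%R, +oo[) p i t + (2 * e i)%:E)%E.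
  have [_ phiM LE phiEE] := HphiE i.
  have e20 : 0 <= e i * e i by rewrite mulr_ge0// ltW.
  have MM : 0 <= 2 * M i by rewrite ME mulr_ge0.
  have r0 t : (0 <= (cst (e i * e i)%:E \_ `[0%R, (2 * M i)%R]) t)%E.
    by rewrite /patch; case: ifP => // _; rewrite lee_fin.
  have mr : measurable_fun [set: R] (cst (e i * e i)%:E \_ `[0%R, (2 * M i)%R]).
    by apply/(measurable_restrictT _ _).1.
  rewrite choquetE.
  apply: (@le_trans _ _ (\int[leb]_(t in `]0%R, +oo[)
      (p i t + (cst (e i * e i)%:E \_ `[0%R, (2 * M i)%R]) t))%E).
    apply: ge0_le_integral => //.
    - by move=> t _; exact: lebesgue_outer_ge0.
    - apply: nonincreasing_emeasurable => // s t st.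
      by apply: le_lebesgue_outer => x /=; apply: le_lt_trans; rewrite lee_fin.
    - apply: emeasurable_funD; first exact: mp.
      exact: measurable_funTS.
    - move=> t /=; rewrite in_itv/= andbT => t0.
      exact: (superlevel_approx (e0 i) (ltW t0) phiM LE phiEE).
  rewrite ge0_integralD//; last 3 first.
  - by move=> t _; exact: h0.
  - exact: mp.
  - exact: measurable_funTS.
  rewrite leeD2l// -integral_mkcondr integral_cst; last exact: measurableI.
  apply: (@le_trans _ _ ((e i * e i)%:E * leb `[0%R, (2 * M i)%R])%E).
    by rewrite lee_pmul2l ?lte_fin ?mulr_gt0// le_measure ?inE//; exact: measurableI.
  rewrite lebesgue_measure_itv/= lte_fin ME mulr_gt0//= oppr0 adde0 -EFinM lee_fin.
  have ei : e i * i.+1%:R = 1 by rewrite mulVf.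
  by rewrite -mulrA [e i * (2 * _)]mulrCA ei mulr1 mulrC.
have p0 : (\int[leb]_(t in `]0%R, +oo[) p i t)%E @[i --> \oo] --> 0%E.
  have [] := @dominated_convergence _ _ R leb (`]0%R, +oo[ : set R) _ p (cst 0%E)
    (fun t => h (t / 2)).
  - exact: measurable_itv.
  - by move=> k; exact: mp.
  - exact: measurable_cst.
  - apply: aeW => t /=; rewrite in_itv/= andbT => t0.
    (* Once [e i <= t], the shifted level is at least [M i], so Chebyshev bounds [p i t] by
       [C / i.+1]. *)
    apply: (@squeeze_cvge _ _ _ _ (cst 0%E) _ (fun i => (C * e i)%:E)).
    + near=> i; rewrite h0/=.
      apply: (@le_trans _ _ (h i.+1%:R)); last first.
        exact: (hC i.+1%:R (ltr0Sn _ _)).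
      apply: hni; rewrite /level_shift ifF; first by rewrite ME le_max lexx.
      apply/negbTE; rewrite -leNgt; apply: ltW; near: i.
      by apply: (cvgr_lt (0 : R)) => //; exact: cvg_harmonic.
    + exact: cvg_cst.
    + apply: cvg_EFin; first exact: nearW.
      rewrite -[X in _ --> X](mulr0 C); apply: cvgM; first exact: cvg_cst.
      exact: cvg_harmonic.
  - apply/integrableP; split.
      apply: nonincreasing_emeasurable => // s t st.
      by apply: hni; rewrite ler_pM2r.
    under eq_integral do rewrite gee0_abs//.
    rewrite ge0_integral_half//; last exact: mh.
    by rewrite -choquetE CE -EFinM ltry.
  - apply: aeW => t i _; rewrite gee0_abs; last exact: h0.
    exact/hni/level_shift_ge.
  - by move=> _ _; rewrite integral0.
apply: (@squeeze_cvge _ _ _ _ (cst 0%E) _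
  (fun i => \int[leb]_(t in `]0%R, +oo[) p i t + (2 * e i)%:E)%E).
- apply: nearW => i; rewrite bound andbT; apply: integral_ge0 => t _.
  exact: hcontent_ge0.
- exact: cvg_cst.
- rewrite -[X in _ --> X](adde0 0%E); apply: cvgeD => //.
  apply: cvg_EFin; first exact: nearW.
  rewrite -[X in _ --> X](mulr0 2); apply: cvgM; first exact: cvg_cst.
  exact: cvg_harmonic.
Unshelve. all: by end_near.
Qed.

End limit_of_measurable.

Theorem theorem5p9 (R : realType) (n : nat) (delta : R)
    (hdelta0 : 0 < delta) (hdelta : delta <= n.+1%:R)
    (f : 'rV[R]_n.+1 -> \bar R) (hf : NL1 delta setT f) :
  (delta = n.+1%:R -> lebesgue_measurable f ->
     NL1_limit_of_continuous delta f) /\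
  (NL1_limit_of_continuous delta f -> lebesgue_measurable f).
Proof.
split; last exact: NL1_limit_measurable.
by move=> deltan; rewrite deltan in hf *; exact: measurable_NL1_limit.
Qed.
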